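(* Let $X$ be a real Hilbert space, let $U$ and $V$ be closed linear subspaces of $X$, let $T = P_V(2P_U-\mathrm{Id})+\mathrm{Id}-P_U$ be the associated Douglas--Rachford operator, and let $c_F$ be the cosine of the Friedrichs angle between $U$ and $V$. Let $x\in X$. Then, as $n\to\infty$, in norm, $$T^nx\to P_{(U\cap V)+(U^\perp\cap V^\perp)}x,\qquad P_UT^nx\to P_{U\cap V}x,\qquad P_VT^nx\to P_{U\cap V}x.$$ If $U+V$ is closed, then $c_F<1$ and the convergence of each of these three sequences is linear with rate $c_F$.
   Context: $X$ is a real Hilbert space (possibly infinite-dimensional) with inner product $\langle\cdot,\cdot\rangle$ and norm $\|\cdot\|$. For a closed subspace $W$ of $X$, $P_W$ is the orthogonal projection onto $W$ and $W^\perp$ its orthogonal complement; $\mathrm{Id}$ is the identity operator. The sum $(U\cap V)+(U^\perp\cap V^\perp)$ is an orthogonal sum of closed subspaces, hence a closed subspace. The cosine of the Friedrichs angle between $U$ and $V$ is $$c_F = c_F(U,V) := \sup\{\langle u,v\rangle : u\in U\cap(U\cap V)^\perp,\ v\in V\cap(U\cap V)^\perp,\ \|u\|\le 1,\ \|v\|\le 1\}.$$ A sequence $(x_n)_{n\in\mathbb{N}}$ converges to $z$ linearly with rate $\gamma\in[0,1)$ if there is a constant $C\ge0$ such that $\|x_n-z\|\le C\gamma^n$ for all $n\in\mathbb{N}=\{0,1,2,\ldots\}$, with $0^0=1$ (for $\gamma\in(0,1)$: $(\gamma^{-n}\|x_n-z\|)_{n\in\mathbb{N}}$ is bounded). *)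

(* Defs.v *)
From HB Require Import structures.
From mathcomp Require Import all_boot all_order all_algebra.
From mathcomp Require Import all_classical all_reals all_analysis.

Set Implicit Arguments.
Unset Strict Implicit.
Unset Printing Implicit Defensive.

Import Order.TTheory GRing.Theory Num.Theory.
Import numFieldNormedType.Exports.

Local Open Scope classical_set_scope.
Local Open Scope ring_scope.

(* Over the reals with the identity as conjugation, [{dot X for idfun}] is the
   type of symmetric positive definite bilinear forms. *)
HB.mixin Record CompleteNormedModule_isHilbert (R : realType) (X : Type)
    & CompleteNormedModule R X := {
  inner : {dot X for (@idfun R)} ;
  innerE : forall x : X, inner x x = `|x| ^+ 2
}.

#[short(type="hilbertType")]
HB.structure Definition Hilbert (R : realType) :=
  {X of CompleteNormedModule R X & CompleteNormedModule_isHilbert R X}.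

Definition closed_subspace (R : realType) (X : hilbertType R) (W : set X) :=
  submod_closed (mem W) /\ closed W.

Definition orth_compl (R : realType) (X : hilbertType R)
  (W : set X) : set X := [set x | forall w, W w -> inner x w = 0].

Definition minkowski_sum (R : realType) (X : hilbertType R) (U V : set X) :
  set X := [set u + v | u in U & v in V].

(* The default value 0 is never used for closed subspaces: there the point p
   exists (projection theorem) and is unique. *)
Definition orth_proj (R : realType) (X : hilbertType R) (W : set X) (x : X) : X :=
  xget 0 [set p | W p /\ orth_compl W (x - p)].

Definition douglas_rachford (R : realType) (X : hilbertType R) (U V : set X)
  (x : X) : X := orth_proj V (2 *: orth_proj U x - x) + x - orth_proj U x.

(* [sup] is the supremum in R; the set is nonempty and, by Cauchy-Schwarz,
   bounded by 1. *)
Definition friedrichs_cos (R : realType) (X : hilbertType R) (U V : set X) : R :=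
  sup [set inner u v | u in [set u | (U `&` orth_compl (U `&` V)) u /\ `|u| <= 1]
                     & v in [set v | (V `&` orth_compl (U `&` V)) v /\ `|v| <= 1]].

(* For gamma = 0 this uses 0 ^+ 0 = 1. *)
Definition linear_cvg (R : realType) (X : hilbertType R) (gamma : R)
  (x_ : nat -> X) (z : X) : Prop :=
  0 <= gamma < 1 /\
  exists2 C : R, 0 <= C & forall n : nat, `|x_ n - z| <= C * gamma ^+ n.

(* Main.v *)
(* T = Q P + (id - Q)(id - P), with P, Q the projections onto U, V, is linear and
   satisfies |T z|^2 = <T z, z>. For such an operator |z - T z|^2 is at most
   |z|^2 - |T z|^2, so iterates vanish on the closure of the range of id - T, whose
   orthogonal complement is Fix T = F; this gives the strong convergence.
   For the rate, each half of |T w|^2 = |Q P w|^2 + |(id - Q)(id - P) w|^2 is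
   bounded through the Friedrichs angle when w is orthogonal to F and U + V is
   closed, so T contracts the complement of F by c_F.
   Finally c_F < 1 follows from Banach-Steinhaus applied to the Neumann sums of
   the alternating projections Q P Q. *)

From HB Require Import structures.
Require Import Defs.
From mathcomp Require Import all_boot all_order all_algebra.
From mathcomp Require Import all_classical all_reals all_analysis.
From mathcomp Require Import ring lra.
Import Order.TTheory GRing.Theory Num.Theory.
Import numFieldNormedType.Exports.
Local Open Scope classical_set_scope.
Local Open Scope ring_scope.

Set Implicit Arguments.
Unset Strict Implicit.
Unset Printing Implicit Defensive.

(** * Inner products, subspaces and orthogonal complements *)

Section Inner.
Context {R : realType} {X : hilbertType R}.
Implicit Types (x y z : X) (a : R) (W : set X).

Lemma innerC x y : inner x y = inner y x.
Proof. by rewrite (hermC inner) expr0 mul1r. Qed.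

Lemma innerDl x y z : inner (x + y) z = inner x z + inner y z.
Proof. exact: linearDl. Qed.

Lemma innerNl x z : inner (- x) z = - inner x z.
Proof. exact: linearNl. Qed.

Lemma innerZl a x z : inner (a *: x) z = a * inner x z.
Proof. by rewrite linearZl. Qed.

Lemma innerDr x y z : inner z (x + y) = inner z x + inner z y.
Proof. by rewrite !(innerC z) innerDl. Qed.

Lemma innerNr x z : inner z (- x) = - inner z x.
Proof. by rewrite !(innerC z) innerNl. Qed.

Lemma innerZr a x z : inner z (a *: x) = a * inner z x.
Proof. by rewrite !(innerC z) innerZl. Qed.

Lemma inner0l z : inner 0 z = 0.
Proof. by rewrite -(scale0r 0) innerZl mul0r. Qed.

Lemma inner0r z : inner z 0 = 0.
Proof. by rewrite innerC inner0l. Qed.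

Definition innerDE := (innerDl, innerDr, innerNl, innerNr, innerZl, innerZr).

Lemma normsqD x y : `|x + y| ^+ 2 = `|x| ^+ 2 + 2 * inner x y + `|y| ^+ 2.
Proof. rewrite -!innerE !innerDE (innerC y x); ring. Qed.

Lemma normsqB x y : `|x - y| ^+ 2 = `|x| ^+ 2 - 2 * inner x y + `|y| ^+ 2.
Proof. rewrite -!innerE !innerDE (innerC y x); ring. Qed.

Lemma normsq_eq0 x : `|x| ^+ 2 <= 0 -> x = 0.
Proof.
move=> x0; apply/eqP; rewrite -normr_eq0 -sqrf_eq0; apply/eqP/le_anti.
by rewrite x0 sqr_ge0.
Qed.

(** Cauchy-Schwarz: for nonzero [x] and [y], expand the squared norm of |y| x - |x| y and cancel the
    positive factor 2 |x| |y|. *)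
Lemma inner_le_norm x y : inner x y <= `|x| * `|y|.
Proof.
have [->|x0] := eqVneq x 0; first by rewrite inner0l normr0 mul0r.
have [->|y0] := eqVneq y 0; first by rewrite inner0r normr0 mulr0.
have xp : 0 < `|x| by rewrite normr_gt0.
have yp : 0 < `|y| by rewrite normr_gt0.
have := sqr_ge0 `| `|y| *: x - `|x| *: y|.
rewrite normsqB !normrZ !normr_id !innerDE.
have -> : (`|y| * `|x|) ^+ 2 - 2 * (`|y| * (`|x| * inner x y)) +
  (`|x| * `|y|) ^+ 2 = (2 * (`|x| * `|y|)) * (`|x| * `|y| - inner x y) by ring.
by rewrite pmulr_rge0 ?subr_ge0// mulr_gt0// mulr_gt0.
Qed.

Lemma cvg_inner_l {T} {F : set_system T} {FF : Filter F} (u : T -> X) x y :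
  u @ F --> x -> inner (u t) y @[t --> F] --> inner x y.
Proof.
move=> ux; have e n : `|inner x y - inner (u n) y| <= `|x - u n| * `|y|.
  rewrite -innerNl -innerDl ler_norml inner_le_norm andbT lerNl.
  by rewrite -innerNl (le_trans (inner_le_norm _ _))// normrN.
apply/cvgrPdist_lt => eps eps0.
(* Adding 1 keeps the divisor below positive when [y = 0]. *)
have y1 : 0 < `|y| + 1 by rewrite ltr_wpDl.
near=> t; apply: (le_lt_trans (e t)).
apply: (@le_lt_trans _ _ (`|x - u t| * (`|y| + 1))).
  by rewrite ler_wpM2l// lerDl.
rewrite -ltr_pdivlMr//; near: t.
by move/cvgrPdist_lt: ux; apply; rewrite divr_gt0.
Unshelve. all: by end_near. Qed.

Definition subspace W := submod_closed (mem W).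

Lemma subspace0 W : subspace W -> W 0.
Proof. by case=> + _; rewrite inE. Qed.

Lemma subspaceZD W : subspace W -> forall a x y, W x -> W y -> W (a *: x + y).
Proof. by case=> _ + a x y Wx Wy => /(_ a x y); rewrite !inE; apply. Qed.

Lemma subspaceD W : subspace W -> forall x y, W x -> W y -> W (x + y).
Proof. by move=> sW x y Wx Wy; rewrite -(scale1r x); apply: subspaceZD. Qed.

Lemma subspaceZ W : subspace W -> forall a x, W x -> W (a *: x).
Proof.
by move=> sW a x Wx; rewrite -[_ *: _]addr0; apply: subspaceZD => //; exact: subspace0.
Qed.

Lemma subspaceB W : subspace W -> forall x y, W x -> W y -> W (x - y).
Proof. by move=> sW x y Wx Wy; rewrite addrC -scaleN1r; apply: subspaceZD. Qed.

Lemma subspaceI W W' : subspace W -> subspace W' -> subspace (W `&` W').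
Proof.
move=> sW sW'; split; first by rewrite inE; split; exact: subspace0.
move=> a x y; rewrite !inE => -[? ?] [? ?].
by split; apply: subspaceZD.
Qed.

Lemma subspace_sum W W' : subspace W -> subspace W' -> subspace (minkowski_sum W W').
Proof.
move=> sW sW'; split.
  rewrite inE; exists 0; first exact: subspace0.
  by exists 0; rewrite ?addr0//; exact: subspace0.
move=> a x y; rewrite !inE => -[u Wu [v Wv <-]] [u' Wu' [v' Wv' <-]].
exists (a *: u + u'); first exact: subspaceZD.
exists (a *: v + v'); first exact: subspaceZD.
by rewrite scalerDr addrACA.
Qed.

Lemma subspace_orth W : subspace (orth_compl W).
Proof.
split; first by rewrite inE => w _; rewrite inner0l.
move=> a x y; rewrite !inE => xW yW w Ww.
by rewrite !innerDE xW// yW// mulr0 addr0.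
Qed.

Lemma orth_disjoint W x : W x -> orth_compl W x -> x = 0.
Proof. by move=> Wx /(_ x Wx); rewrite innerE => x0; apply: normsq_eq0; rewrite x0. Qed.

Lemma closed_orth W : closed (orth_compl W).
Proof.
have -> : orth_compl W = \bigcap_(w in W) ((fun x => inner x w) @^-1` [set 0]).
  by apply/seteqP; split.
apply: closed_bigI => w _; apply: preimage_closed; last exact: closed_eq.
by move=> x _; exact: cvg_inner_l.
Qed.

Lemma closed_subspace_orth W : closed_subspace (orth_compl W).
Proof. by split; [exact: subspace_orth | exact: closed_orth]. Qed.

Lemma closedI_subspace W W' :
  closed_subspace W -> closed_subspace W' -> closed_subspace (W `&` W').
Proof.
move=> [sW cW] [sW' cW']; split; [exact: subspaceI | exact: closedI].
Qed.

Lemma cvg_normsq_le (u : nat -> X) x (b : nat -> R) :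
  (forall n, `|x - u n| ^+ 2 <= b n) -> b @ \oo --> 0 -> u @ \oo --> x.
Proof.
move=> ub b0; apply/cvgrPdist_lt => eps eps0; have e2 : 0 < eps ^+ 2 by rewrite exprn_gt0.
apply: filterS (cvgr_lt _ b0 _ e2) => n /(le_lt_trans (ub n)).
by rewrite ltr_pXn2r ?nnegrE ?normr_ge0 ?ltW.
Qed.

End Inner.

(** * Existence, uniqueness and basic properties of orthogonal projections *)

Section Projection.
Context {R : realType} {X : hilbertType R}.
Implicit Types (x y z : X) (a : R) (W : set X).

(** The parallelogram law for [x - y] and [x - z], written with the midpoint of [y] and [z] because
    a subspace containing both contains it. *)
Lemma parallelogram x y z :
  `|y - z| ^+ 2 = 2 * `|x - y| ^+ 2 + 2 * `|x - z| ^+ 2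
                  - 4 * `|x - 2^-1 *: (y + z)| ^+ 2.
Proof.
rewrite !normsqB !innerZr innerDr normrZ exprMn normsqD.
by rewrite (@ger0_norm _ 2^-1)//; field.
Qed.

Lemma minimizing_cvg W x (d : R) (u : nat -> X) : subspace W ->
  (forall w, W w -> d <= `|x - w| ^+ 2) ->
  (forall n, W (u n) /\ `|x - u n| ^+ 2 < d + n.+1%:R^-1) -> cvgn u.
Proof.
move=> sW dW uP; apply/cauchy_cvgP/cauchy_exP => e e0.
(* Midpoints stay in [W], at squared distance at least [d], so the parallelogram law leaves at most
   2/(N+1) + 2/(n+1) <= 4/(N+1); hence the 4. *)
have e2 : 0 < e ^+ 2 / 4 by rewrite divr_gt0// exprn_gt0.
have [N _ /(_ N (leqnn N)) Ne] := near_infty_natSinv_lt (PosNum e2).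
exists (u N); exists N => // n /= Nn; rewrite -ball_normE /=.
have [[WN uN] [Wn un]] := (uP N, uP n).
rewrite -(ltr_pXn2r (n := 2)) ?nnegrE ?normr_ge0 ?ltW// (parallelogram x).
have /dW : W (2^-1 *: (u N + u n)) by apply: subspaceZ => //; apply: subspaceD.
have : n.+1%:R^-1 <= N.+1%:R^-1 :> R by rewrite lef_pV2 ?posrE// ler_nat.
move: Ne uN un => /=; move: N.+1%:R^-1 n.+1%:R^-1 (`|_ - u N| ^+ 2) => p q b.
move: (`|_ - u n| ^+ 2) (`|_ - _ *: _| ^+ 2) (e ^+ 2) => s t r; lra.
Qed.

(** First-order condition: for r = s/(k+1), testing at [t = r] gives r^2 (k+1) <= r^2 k, so r = 0.
    The added 1 covers [k = 0]. *)
Lemma linear_le_quadratic_eq0 (s k : R) : 0 <= k ->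
  (forall t, t * s <= t ^+ 2 * k) -> s = 0.
Proof.
move=> k0 h; have k1 : k + 1 != 0 by rewrite gt_eqF// ltr_wpDl.
have [r sE] : exists r, s = r * (k + 1) by exists (s / (k + 1)); rewrite divfK.
have := h r; rewrite sE => hr.
have : r ^+ 2 = 0 by apply/le_anti; rewrite sqr_ge0 andbT; nra.
by move/eqP; rewrite sqrf_eq0 => /eqP ->; rewrite mul0r.
Qed.

Lemma minimizer_orth W x p : subspace W -> W p ->
  (forall w, W w -> `|x - p| ^+ 2 <= `|x - w| ^+ 2) -> orth_compl W (x - p).
Proof.
move=> sW Wp pmin w Ww.
apply: (@linear_le_quadratic_eq0 _ (2^-1 * `|w| ^+ 2)) => [|t].
  by rewrite mulr_ge0// sqr_ge0.
(* Comparing [p] with this perturbation gives 2 t <x - p, w> <= t^2 |w|^2. *)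
have /pmin : W (t *: w + p) by apply: subspaceZD.
rewrite opprD addrCA addrC [X in _ <= X]normsqB innerZr normrZ exprMn.
rewrite real_normK ?num_real//; lra.
Qed.

(** A minimizing sequence for the squared distance converges; closedness keeps its limit in [W], and
    continuity of the norm makes the limit a minimizer. *)
Lemma projection_theorem W x : closed_subspace W ->
  exists p, W p /\ orth_compl W (x - p).
Proof.
move=> [sW cW]; set E := [set `|x - w| ^+ 2 | w in W].
have infE : has_inf E.
  split; first by exists (`|x - 0| ^+ 2), 0 => //; exact: subspace0.
  by exists 0 => _ [w _ <-]; exact: sqr_ge0.
have dW w : W w -> inf E <= `|x - w| ^+ 2.
  by move=> Ww; apply: ge_inf; [exact: infE.2 | exists w].
have /choice[u uP] : forall n, exists w, W w /\ `|x - w| ^+ 2 < inf E + n.+1%:R^-1.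
  move=> n; have [|_ [w Ww <-] lt] := @inf_adherent _ E n.+1%:R^-1 _ infE.
    by rewrite invr_gt0.
  by exists w.
have /cvg_ex[p up] := minimizing_cvg sW dW uP.
have Wp : W p by apply: closed_cvg cW _ _ up; apply: nearW => n; case: (uP n).
exists p; split => //; apply: minimizer_orth => // w Ww.
apply: le_trans (dW w Ww).
have xup : `|x - u n| ^+ 2 @[n --> \oo] --> `|x - p| ^+ 2.
  by apply: cvgM; apply: cvg_norm; apply: cvgB => //; exact: cvg_cst.
have dn : inf E + n.+1%:R^-1 @[n --> \oo] --> inf E.
  by rewrite -[X in _ --> X]addr0; apply: cvgD; [exact: cvg_cst | exact: cvg_harmonic].
apply: ler_cvg_to xup dn _; apply: nearW => n; apply: ltW; exact: (uP n).2.
Qed.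

(** Two candidates differ by a vector of [W] that is orthogonal to [W], hence by 0, so [xget] can
    only return [p]. *)
Lemma orth_proj_eq W x p : subspace W -> W p -> orth_compl W (x - p) ->
  orth_proj W x = p.
Proof.
move=> sW Wp xp; rewrite /orth_proj; case: xgetP => [q _ [Wq xq]|/(_ p)[]//].
apply/eqP; rewrite -subr_eq0; apply/eqP/(orth_disjoint (subspaceB sW Wq Wp)).
have -> : q - p = (x - p) - (x - q) by rewrite opprB [RHS]addrC addrA subrK.
by apply: (subspaceB (subspace_orth _)).
Qed.

Lemma orth_proj_sum W y z : subspace W -> W y -> orth_compl W z ->
  orth_proj W (y + z) = y.
Proof. by move=> sW Wy zW; apply: orth_proj_eq; rewrite // [y + z]addrC addrK. Qed.

Lemma orth_proj_id W x : subspace W -> W x -> orth_proj W x = x.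
Proof.
by move=> sW Wx; apply: orth_proj_eq => //; rewrite subrr => w _; rewrite inner0l.
Qed.

Lemma orth_proj_orth W x : subspace W -> orth_compl W x -> orth_proj W x = 0.
Proof. by move=> sW xW; apply: orth_proj_eq; rewrite ?subr0//; exact: subspace0. Qed.

(** Bundles a map with its linearity proof, so that generic results on linear maps apply to it. *)
Definition linear_pack (f : X -> X) (lf : linear f) : {linear X -> X} :=
  HB.pack f (GRing.isLinear.Build R X X _ f lf).

Section ClosedSubspace.
Variables (W : set X) (csW : closed_subspace W).
Let P := orth_proj W.
Let sW : subspace W := csW.1.

Lemma orth_projP x : W (P x) /\ orth_compl W (x - P x).
Proof.
by have [p [Wp xp]] := projection_theorem x csW; rewrite /P (orth_proj_eq sW Wp xp).
Qed.

Lemma orth_proj_in x : W (P x). Proof. exact: (orth_projP x).1. Qed.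

Lemma orth_proj_res x : orth_compl W (x - P x). Proof. exact: (orth_projP x).2. Qed.

Lemma orth_proj_linear : linear P.
Proof.
move=> a x y; apply: orth_proj_eq => //.
  by apply: subspaceZD => //; exact: orth_proj_in.
rewrite opprD addrACA -scalerBr.
by apply: (subspaceZD (subspace_orth _)); exact: orth_proj_res.
Qed.

Lemma orth_projB : {morph P : x y / x - y}.
Proof. exact: (raddfB (linear_pack orth_proj_linear)). Qed.

Lemma inner_orth_projr x y : W x -> inner x (P y) = inner x y.
Proof.
move=> Wx; have /(_ x Wx) := orth_proj_res y; rewrite innerDl innerNl.
by rewrite (innerC y) (innerC _ x) => /subr0_eq.
Qed.

Lemma inner_orth_projC x y : inner (P x) y = inner x (P y).
Proof.
rewrite -(inner_orth_projr y (orth_proj_in x)).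
by rewrite innerC inner_orth_projr 1?innerC//; exact: orth_proj_in.
Qed.

Lemma inner_orth_proj x : inner (P x) x = `|P x| ^+ 2.
Proof. by rewrite -innerE inner_orth_projr//; exact: orth_proj_in. Qed.

Lemma orth_proj_pythagoras x : `|x| ^+ 2 = `|P x| ^+ 2 + `|x - P x| ^+ 2.
Proof. rewrite normsqB (innerC x) inner_orth_proj; ring. Qed.

Lemma norm_orth_proj x : `|P x| <= `|x|.
Proof.
by rewrite -(ler_pXn2r (n := 2))// ?nnegrE// (orth_proj_pythagoras x) lerDl sqr_ge0.
Qed.

(** Pythagoras then forces the residual to vanish. *)
Lemma orth_proj_fix x : `|x| <= `|P x| -> W x.
Proof.
rewrite -(ler_pXn2r (n := 2)) ?nnegrE// {1}(orth_proj_pythagoras x) gerDl.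
by move/normsq_eq0/subr0_eq => ->; exact: orth_proj_in.
Qed.

Lemma cvg_orth_proj (u : nat -> X) x : u @ \oo --> x -> P (u n) @[n --> \oo] --> P x.
Proof.
move=> ux; apply/cvgrPdist_lt => e e0; move/cvgrPdist_lt : ux => /(_ _ e0).
by apply: filterS => n; apply: le_lt_trans; rewrite -orth_projB norm_orth_proj.
Qed.

End ClosedSubspace.
End Projection.

(** * Iterates of firmly nonexpansive linear operators *)

Section FirmlyNonexpansive.
Context {R : realType} {X : hilbertType R}.
Variable L : {linear X -> X}.
Hypothesis firm : forall z, `|L z| ^+ 2 <= inner (L z) z.
Implicit Types (x y z : X).

Let vanishing : set X := [set w | iter n L w @[n --> \oo] --> 0].

Lemma firm_residual z : `|z - L z| ^+ 2 <= `|z| ^+ 2 - `|L z| ^+ 2.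
Proof. by rewrite normsqB (innerC z); have := firm z; lra. Qed.

Lemma firm_nonexpansive z : `|L z| <= `|z|.
Proof.
rewrite -(ler_pXn2r (n := 2)) ?nnegrE// -subr_ge0.
exact: le_trans (sqr_ge0 _) (firm_residual z).
Qed.

Lemma firm_iter_nonexpansive n z : `|iter n L z| <= `|z|.
Proof. by elim: n => //= n; apply: le_trans; exact: firm_nonexpansive. Qed.

Lemma iter_linearB n x y : iter n L (x - y) = iter n L x - iter n L y.
Proof. by elim: n => //= n ->; rewrite linearB. Qed.

(** The numbers |L^n z|^2 decrease and are bounded below, so their consecutive gaps tend to 0; by
    [firm_residual] these gaps dominate |L^n (z - L z)|^2. *)
Lemma firm_asymptotically_regular z : vanishing (z - L z).
Proof.
rewrite /vanishing /=; set a := fun n => `|iter n L z| ^+ 2.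
have ca : cvgn a.
  apply: nonincreasing_is_cvgn.
    apply/nonincreasing_seqP => n; rewrite /a /=.
    by rewrite ler_pXn2r ?nnegrE//; exact: firm_nonexpansive.
  by exists 0 => _ [n _ <-]; exact: sqr_ge0.
apply: (@cvg_normsq_le _ _ _ _ (fun n => a n - a n.+1)).
  move=> n; rewrite sub0r normrN iter_linearB -iterSr /=; exact: firm_residual.
rewrite -[X in _ --> X](subrr (limn a)); apply: cvgB => //.
by rewrite (cvg_shiftS a).
Qed.

Lemma subspace_vanishing : subspace vanishing.
Proof.
split.
  rewrite inE /vanishing /=; apply: cvg_near_cst; apply: nearW => n.
  by elim: n => //= n ->; rewrite linear0.
move=> a x y; rewrite !inE /vanishing /= => x0 y0.
have -> : (fun n => iter n L (a *: x + y)) = (fun n => a *: iter n L x + iter n L y).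
  by apply/funext; elim=> //= n ->; rewrite linearP.
by rewrite -[X in _ --> X]addr0 -[X in X + _](scaler0 _ a); apply: cvgD => //; exact: cvgZr.
Qed.

(** All iterates are nonexpansive, so an approximation of [x] by a vanishing [y] survives uniformly
    in [n]. *)
Lemma closed_vanishing : closed vanishing.
Proof.
move=> x xc; apply/cvgrPdist_lt => e e0; have e2 : 0 < e / 2 by rewrite divr_gt0.
have [y [/cvgrPdist_lt/(_ _ e2) y0 xy]] := xc _ (nbhsx_ballx x _ e2).
apply: filterS y0 => n; rewrite !sub0r !normrN => yn.
rewrite -(subrK y x) (splitr e) [iter _ _ _](_ : _ = iter n L (x - y) + iter n L y).
  apply: le_lt_trans (ler_normD _ _) _; apply: ltrD => //.
  apply: le_lt_trans (firm_iter_nonexpansive _ _) _.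
  by move: xy; rewrite -ball_normE.
by rewrite iter_linearB !subrK.
Qed.

(** Fixed points of [L] are also fixed by its adjoint: in [firm] at [f + t *: z] the constant terms
    cancel, and the term linear in [t] must vanish. *)
Lemma firm_fix_adjoint f z : L f = f -> inner f (L z) = inner f z.
Proof.
move=> Lf; apply/eqP; rewrite -subr_eq0; apply/eqP.
apply: (@linear_le_quadratic_eq0 _ _ (inner (L z) z - `|L z| ^+ 2)) => [|t].
  by rewrite subr_ge0.
have := firm (f + t *: z).
rewrite linearD linearZ Lf normsqD innerZr normrZ exprMn real_normK ?num_real//.
rewrite !innerDE innerE (innerC (L z) f); nra.
Qed.

Lemma subspace_fix : subspace [set v | L v = v].
Proof.
split; first by rewrite inE /= linear0.
by move=> a x y; rewrite !inE /= linearP => -> ->.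
Qed.

Lemma orth_vanishing_fix v : orth_compl vanishing v -> L v = v.
Proof.
move=> /(_ _ (firm_asymptotically_regular v)); rewrite innerDr innerNr innerE => vLv.
apply/esym/subr0_eq/normsq_eq0; rewrite normsqB.
by have := firm v; rewrite (innerC (L v)); lra.
Qed.

(* The vectors with vanishing orbit form a closed subspace containing the range
   of [id - L], and a vector [v] orthogonal to that range is fixed because
   [`|v| ^+ 2 = inner v (L v)]. *)
Lemma firm_iter_cvg x : iter n L x @[n --> \oo] --> orth_proj [set v | L v = v] x.
Proof.
have [w [w0 vw]] := projection_theorem x (conj subspace_vanishing closed_vanishing).
set v := x - w; have Lv : L v = v by exact: orth_vanishing_fix.
rewrite (@orth_proj_eq _ _ _ _ v subspace_fix)//.
  have -> : (fun n => iter n L x) = (fun n => v + iter n L w).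
    apply/funext => n; have {1}-> : x = w - - v by rewrite opprK addrC subrK.
    rewrite iter_linearB addrC; congr (_ + _).
    by elim: n => [|n /= /(congr1 L)]; rewrite ?opprK// linearN Lv.
  by rewrite -[X in _ --> X]addr0; apply: cvgD => //; exact: cvg_cst.
rewrite opprB addrC subrK => f /= Lf.
(* The residual [w] is orthogonal to each fixed [f]: its orbit has constant inner product with [f],
   yet tends to 0. *)
have wf n : inner (iter n L w) f = inner w f.
  by elim: n => //= n <-; rewrite innerC firm_fix_adjoint// innerC.
have : inner (iter n L w) f @[n --> \oo] --> (0 : R).
  by rewrite -(inner0l f); exact: cvg_inner_l.
rewrite (funext wf : (fun n => inner (iter n L w) f) = cst (inner w f)) => w0f.
exact: cvg_unique (cvg_cst _) w0f.
Qed.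

End FirmlyNonexpansive.

(** * The Douglas-Rachford operator: firmness, fixed points and strong convergence *)

Section DouglasRachford.
Context {R : realType} {X : hilbertType R}.
Variables (U V : set X) (csU : closed_subspace U) (csV : closed_subspace V).
Implicit Types (x y z u v w f : X).
Let P := orth_proj U.
Let Q := orth_proj V.
Let T := douglas_rachford U V.
Let F := minkowski_sum (U `&` V) (orth_compl U `&` orth_compl V).
Let sU : subspace U := csU.1.
Let sV : subspace V := csV.1.
Let csUV : closed_subspace (U `&` V) := closedI_subspace csU csV.
Let csC : closed_subspace (orth_compl U `&` orth_compl V) :=
  closedI_subspace (closed_subspace_orth U) (closed_subspace_orth V).

Lemma douglas_rachfordE x : T x = Q (P x) + ((x - P x) - Q (x - P x)).
Proof.
rewrite /T /douglas_rachford -/P -/Q.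
have -> : 2 *: P x - x = P x - (x - P x).
  by rewrite scaler_nat mulr2n opprB addrA.
by rewrite /Q orth_projB// -!addrA; congr (_ + _); rewrite addrC addrA.
Qed.

Lemma douglas_rachford_linear : linear T.
Proof.
move=> a x y; rewrite !douglas_rachfordE.
have PL z t : P (a *: z + t) = a *: P z + P t by exact: orth_proj_linear.
have QL z t : Q (a *: z + t) = a *: Q z + Q t by exact: orth_proj_linear.
have sub z t z' t' : (a *: z + t) - (a *: z' + t') = a *: (z - z') + (t - t').
  by rewrite opprD addrACA -scalerBr.
by rewrite PL QL sub QL sub !scalerDr addrACA.
Qed.

(** Pythagoras: the two summands of [T x] lie in [V] and in its orthogonal complement. *)
Lemma norm_douglas_rachford x :
  `|T x| ^+ 2 = `|Q (P x)| ^+ 2 + `|(x - P x) - Q (x - P x)| ^+ 2.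
Proof.
rewrite douglas_rachfordE normsqD [inner _ _]innerC.
by rewrite orth_proj_res ?mulr0 ?addr0//; exact: orth_proj_in.
Qed.

Lemma douglas_rachford_firm x : `|T x| ^+ 2 = inner (T x) x.
Proof.
(* Used with [a = P x] and [b = x - P x]; the cross terms <Q a, b> and <Q b, a> cancel because [Q]
   is self-adjoint. *)
have firm a b : inner a b = 0 ->
    `|Q a| ^+ 2 + `|b - Q b| ^+ 2 = inner (Q a + (b - Q b)) (a + b).
  move=> ab; rewrite normsqB !innerDE (innerC b a) ab !(inner_orth_proj csV) -/Q innerE.
  rewrite (innerC b (Q b)) (inner_orth_proj csV) -/Q (inner_orth_projC csV b) -/Q.
  rewrite (innerC b); ring.
rewrite norm_douglas_rachford douglas_rachfordE firm ?[P x + _]addrC ?subrK//.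
by rewrite innerC orth_proj_res//; exact: orth_proj_in.
Qed.

(** If [T x = x], comparing the splittings of |x|^2 given by [P] and by [T] forces both losses, P x
    - Q (P x) and Q (x - P x), to be 0. *)
Lemma douglas_rachford_fix : [set x | T x = x] = F.
Proof.
apply/seteqP; split => [x /= Tx|x [a [Ua Va] [b [bU bV] <-]]] /=.
  have := norm_douglas_rachford x; rewrite Tx (orth_proj_pythagoras csU x) -/P.
  set b := x - P x => xE.
  have := orth_proj_pythagoras csV b; rewrite -/Q => bE.
  have := orth_proj_pythagoras csV (P x); rewrite -/Q => PE.
  have VPx : V (P x).
    have /normsq_eq0/subr0_eq -> : `|P x - Q (P x)| ^+ 2 <= 0.
      by have := sqr_ge0 `|Q b|; lra.
    exact: orth_proj_in.
  have Qb : Q b = 0 by apply: normsq_eq0; have := sqr_ge0 `|P x - Q (P x)|; lra.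
  exists (P x); first by split => //; exact: orth_proj_in.
  exists b; last by rewrite addrC subrK.
  split; first exact: orth_proj_res.
  by rewrite -[b]subr0 -Qb; exact: orth_proj_res.
rewrite douglas_rachfordE /P /Q (orth_proj_sum sU)// [a + b]addrC addrK.
by rewrite (orth_proj_id sV)// (orth_proj_orth sV)// subr0 addrC.
Qed.

Let subspaceF : subspace F.
Proof. by apply: subspace_sum; [exact: csUV.1 | exact: csC.1]. Qed.

(** The two summands of [F] are mutually orthogonal, so each tests only its own projection. *)
Lemma sumF_proj_spec x :
  let p := orth_proj (U `&` V) x + orth_proj (orth_compl U `&` orth_compl V) x in
  F p /\ orth_compl F (x - p).
Proof.
set a := orth_proj _ x; set b := orth_proj _ x.
have aUV : (U `&` V) a by exact: (orth_proj_in csUV).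
have bC : (orth_compl U `&` orth_compl V) b by exact: (orth_proj_in csC).
split=> [|_ [c cUV [d dC <-]]]; first by exists a => //; exists b.
have ab w z : (U `&` V) w -> (orth_compl U `&` orth_compl V) z -> inner w z = 0.
  by move=> [Uw _] [zU _]; rewrite innerC; exact: zU.
have xa : inner (x - a) c = 0 by exact: orth_proj_res cUV.
have xb : inner (x - b) d = 0 by exact: orth_proj_res dC.
have := ab _ _ aUV dC; have := ab _ _ cUV bC.
move: xa xb; rewrite !innerDE (innerC c b); lra.
Qed.

Lemma orth_proj_sumF x :
  orth_proj F x = orth_proj (U `&` V) x + orth_proj (orth_compl U `&` orth_compl V) x.
Proof. by have [Fp xp] := sumF_proj_spec x; exact: orth_proj_eq. Qed.

Lemma orth_proj_sumFP x : F (orth_proj F x) /\ orth_compl F (x - orth_proj F x).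
Proof. by rewrite orth_proj_sumF; exact: sumF_proj_spec. Qed.

(** [P] keeps the component in [U] and kills the one in its complement; this identifies the limit of
    the sequence projected onto [U]. *)
Lemma orth_projl_F x : P (orth_proj F x) = orth_proj (U `&` V) x.
Proof.
rewrite orth_proj_sumF; apply: orth_proj_sum => //; first exact: (orth_proj_in csUV x).1.
exact: (orth_proj_in csC x).1.
Qed.

Lemma orth_projr_F x : Q (orth_proj F x) = orth_proj (U `&` V) x.
Proof.
rewrite orth_proj_sumF; apply: orth_proj_sum => //; first exact: (orth_proj_in csUV x).2.
exact: (orth_proj_in csC x).2.
Qed.

Lemma douglas_rachford_cvg x : iter n T x @[n --> \oo] --> orth_proj F x.
Proof.
rewrite -douglas_rachford_fix; apply: (firm_iter_cvg (L := linear_pack douglas_rachford_linear)).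
by move=> z; rewrite le_eqVlt; apply/orP; left; apply/eqP/douglas_rachford_firm.
Qed.

(** * The symmetrized alternating projections *)

Let K x := Q (P (Q x)).

Lemma alternating_proj_linear : linear K.
Proof.
by move=> a x y; rewrite /K [Q (_ + _)]orth_proj_linear// [P (_ + _)]orth_proj_linear//
  [Q (_ + _)]orth_proj_linear.
Qed.

(** Self-adjointness gives <K x, x> = |P (Q x)|^2, and [Q] only shortens P (Q x). *)
Lemma alternating_proj_firm x : `|K x| ^+ 2 <= inner (K x) x.
Proof.
rewrite /K (inner_orth_projC csV) -/Q (inner_orth_proj csU) -/P.
by rewrite ler_pXn2r ?nnegrE//; exact: norm_orth_proj.
Qed.

(** A fixed [x] lies in [V], so |x| = |Q (P x)| <= |P x|, which puts it in [U]. *)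
Lemma alternating_proj_fix : [set x | K x = x] = U `&` V.
Proof.
apply/seteqP; split => [x /= Kx|x [Ux Vx]] /=; last first.
  by rewrite /K /P /Q !(orth_proj_id sV)// (orth_proj_id sU).
have Vx : V x by rewrite -Kx; exact: orth_proj_in.
split => //; apply: orth_proj_fix => //; rewrite -{1}Kx /K [Q x](orth_proj_id sV)//.
exact: norm_orth_proj.
Qed.

Lemma alternating_proj_cvg x : iter n K x @[n --> \oo] --> orth_proj (U `&` V) x.
Proof.
rewrite -alternating_proj_fix; apply: (firm_iter_cvg (L := linear_pack alternating_proj_linear)).
exact: alternating_proj_firm.
Qed.

End DouglasRachford.

(** * Friedrichs angle estimates and the linear rate *)

Section Rate.
Context {R : realType} {X : hilbertType R}.
Variables (U V : set X) (csU : closed_subspace U) (csV : closed_subspace V).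
Implicit Types (x y z u v w f : X).
Let P := orth_proj U.
Let Q := orth_proj V.
Let T := douglas_rachford U V.
Let F := minkowski_sum (U `&` V) (orth_compl U `&` orth_compl V).
Let c := friedrichs_cos U V.
Let sU : subspace U := csU.1.
Let sV : subspace V := csV.1.
Let csUV : closed_subspace (U `&` V) := closedI_subspace csU csV.
Let csC : closed_subspace (orth_compl U `&` orth_compl V) :=
  closedI_subspace (closed_subspace_orth U) (closed_subspace_orth V).

Let cos_set := [set inner u v
  | u in [set u | (U `&` orth_compl (U `&` V)) u /\ `|u| <= 1]
  & v in [set v | (V `&` orth_compl (U `&` V)) v /\ `|v| <= 1]].

Let cos_set0 : cos_set 0.
Proof.
have o0 : orth_compl (U `&` V) 0 by move=> w _; rewrite inner0l.
exists 0; first by rewrite /= normr0 ler01; do 2!split => //; exact: subspace0.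
exists 0; first by rewrite /= normr0 ler01; do 2!split => //; exact: subspace0.
exact: inner0l.
Qed.

Let has_sup_cos_set : has_sup cos_set.
Proof.
split; first by exists 0; exact: cos_set0.
exists 1 => _ [u [_ u1] [v [_ v1] <-]].
by rewrite (le_trans (inner_le_norm _ _))// mulr_ile1.
Qed.

Lemma friedrichs_cos_ge0 : 0 <= c.
Proof. exact: sup_upper_bound has_sup_cos_set _ cos_set0. Qed.

Lemma friedrichs_cos_ub (k : R) :
  (forall u v, U u -> V v -> orth_compl (U `&` V) v -> `|u| <= 1 -> `|v| <= 1 ->
     inner u v <= k) -> c <= k.
Proof.
move=> h; apply: ge_sup; first by exists 0; exact: cos_set0.
by move=> _ [u [[Uu _] u1] [v [[Vv v_orth] v1] <-]]; exact: h.
Qed.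

Lemma inner_le_friedrichs u v :
  U u -> orth_compl (U `&` V) u -> V v -> orth_compl (U `&` V) v ->
  inner u v <= c * (`|u| * `|v|).
Proof.
have [->|u0] := eqVneq u 0; first by rewrite inner0l normr0 mul0r mulr0.
have [->|v0] := eqVneq v 0; first by rewrite inner0r normr0 !mulr0.
move=> Uu uo Vv vo; have up : 0 < `|u| by rewrite normr_gt0.
have vp : 0 < `|v| by rewrite normr_gt0.
rewrite -ler_pdivrMr ?mulr_gt0//; apply: (sup_upper_bound has_sup_cos_set).
have n1 w : 0 < `|w| -> `| `|w|^-1 *: w| <= 1.
  by move=> wp; rewrite normrZ gtr0_norm ?invr_gt0// mulVf ?gt_eqF.
exists (`|u|^-1 *: u).
  by split; [split; [exact: (subspaceZ sU) | exact: (subspaceZ (subspace_orth _))] | exact: n1].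
exists (`|v|^-1 *: v).
  by split; [split; [exact: (subspaceZ sV) | exact: (subspaceZ (subspace_orth _))] | exact: n1].
by rewrite innerZl innerZr invfM mulrA mulrC.
Qed.

(** Self-adjointness moves the projection onto the test vector of [W'], which it fixes. *)
Lemma orth_proj_preserves_orth W W' x : closed_subspace W -> W' `<=` W ->
  orth_compl W' x -> orth_compl W' (orth_proj W x).
Proof.
move=> csW W'W xW' w W'w.
by rewrite inner_orth_projC// orth_proj_id ?xW'//; [exact: csW.1 | exact: W'W].
Qed.

(** Divide |Q u|^2 = <u, Q u> <= c |u| |Q u| by |Q u|; [Q u] inherits orthogonality to the
    intersection. *)
Lemma norm_projr_le_friedrichs u : U u -> orth_compl (U `&` V) u -> `|Q u| <= c * `|u|.
Proof.
move=> Uu uo.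
have [->|Q0] := eqVneq (Q u) 0.
  by rewrite normr0 mulr_ge0// friedrichs_cos_ge0.
have Qp : 0 < `|Q u| by rewrite normr_gt0.
rewrite -(ler_pM2r Qp) -expr2 -(inner_orth_proj csV) -/Q innerC -mulrA.
apply: inner_le_friedrichs => //; first exact: orth_proj_in.
by apply: orth_proj_preserves_orth => // w [].
Qed.

Lemma norm_projl_le_friedrichs v : V v -> orth_compl (U `&` V) v -> `|P v| <= c * `|v|.
Proof.
move=> Vv vo.
have [->|P0] := eqVneq (P v) 0.
  by rewrite normr0 mulr_ge0// friedrichs_cos_ge0.
have Pp : 0 < `|P v| by rewrite normr_gt0.
rewrite -(ler_pM2r Pp) -expr2 -(inner_orth_proj csU) -/P -mulrA [`|v| * _]mulrC.
apply: inner_le_friedrichs => //; first exact: orth_proj_in.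
by apply: orth_proj_preserves_orth => // w [].
Qed.

(* This transfers the angle between [U] and [V] to their complements: with
   [p = |P v| ^+ 2], [q = |Q (P v)| ^+ 2] and [n = |v| ^+ 2], Cauchy-Schwarz gives
   [p ^+ 2 <= q * n], hence [n * (p - q) <= p * (n - p) <= c ^+ 2 * n * (n - p)]. *)
Lemma norm_res_le_friedrichs v : V v -> orth_compl (U `&` V) v ->
  `|(v - P v) - Q (v - P v)| ^+ 2 <= c ^+ 2 * `|v - P v| ^+ 2.
Proof.
move=> Vv vo; have [v0|v0] := eqVneq v 0.
  have P0 : P 0 = 0 by apply: orth_proj_id => //; exact: subspace0.
  have Q0 : Q 0 = 0 by apply: orth_proj_id => //; exact: subspace0.
  by rewrite v0 P0 subrr Q0 subrr normr0 expr0n mulr0.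
have n0 : 0 < `|v| ^+ 2 by rewrite exprn_gt0// normr_gt0.
have -> : (v - P v) - Q (v - P v) = - (P v - Q (P v)).
  by rewrite /Q orth_projB// (orth_proj_id sV Vv) opprB addrC addrA addrNK opprB.
rewrite normrN.
have := orth_proj_pythagoras csV (P v); rewrite -/Q => qE.
have := orth_proj_pythagoras csU v; rewrite -/P => pE.
have pq : (`|P v| ^+ 2) ^+ 2 <= `|Q (P v)| ^+ 2 * `|v| ^+ 2.
  rewrite -exprMn ler_pXn2r ?nnegrE ?sqr_ge0 ?mulr_ge0//.
  rewrite -(inner_orth_proj csU) -/P.
  have -> : inner (P v) v = inner (Q (P v)) v.
    by rewrite (inner_orth_projC csV) (orth_proj_id sV Vv).
  exact: inner_le_norm.
have pn : `|P v| ^+ 2 <= c ^+ 2 * `|v| ^+ 2.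
  rewrite -exprMn ler_pXn2r ?nnegrE ?mulr_ge0 ?friedrichs_cos_ge0//.
  exact: norm_projl_le_friedrichs.
have := sqr_ge0 `|v - P v|.
move: n0 qE pE pq pn; move: (`|P v - _| ^+ 2) (`|v - _| ^+ 2) (`|Q _| ^+ 2) => s r q.
move: (`|P v| ^+ 2) (`|v| ^+ 2) (c ^+ 2) => p n d n0 qE pE pq pn r0.
rewrite -(ler_pM2l n0); nra.
Qed.

(** * Consequences of the closedness of U + V *)

Hypothesis clUV : closed (minkowski_sum U V).
Let csS : closed_subspace (minkowski_sum U V) := conj (subspace_sum sU sV) clUV.

Lemma minkowski_suml u : U u -> minkowski_sum U V u.
Proof. by move=> Uu; exists u => //; exists 0; rewrite ?addr0//; exact: subspace0. Qed.

Lemma minkowski_sumr v : V v -> minkowski_sum U V v.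
Proof. by move=> Vv; exists 0; [exact: subspace0 | exists v; rewrite ?add0r]. Qed.

Lemma sum_residual x : minkowski_sum U V x ->
  exists v, [/\ V v, orth_compl (U `&` V) v & x - P x = v - P v].
Proof.
move=> [u Uu [v Vv <-]]; set m := orth_proj (U `&` V) v.
have [Um Vm] : (U `&` V) m by exact: (orth_proj_in csUV).
exists (v - m); split; [exact: subspaceB | exact: (orth_proj_res csUV) |].
have PD y z : P (y + z) = P y + P z by exact: (raddfD (linear_pack (orth_proj_linear csU))).
rewrite PD /P (orth_proj_id sU Uu) orth_projB// (orth_proj_id sU Um).
by rewrite opprD addrACA subrr add0r opprB addrA subrK.
Qed.

(** Closedness provides the projection of [z] onto U + V; its residual [r] is orthogonal to [U] and
    [V], hence to [z] and to the projection, hence to itself. *)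
Lemma orth_orthI_sum z : orth_compl (orth_compl U `&` orth_compl V) z ->
  minkowski_sum U V z.
Proof.
move=> zo; set r := z - orth_proj (minkowski_sum U V) z.
have ro : orth_compl (minkowski_sum U V) r by exact: orth_proj_res.
have rC : (orth_compl U `&` orth_compl V) r.
  by split=> w Ww; apply: ro; [exact: minkowski_suml | exact: minkowski_sumr].
suff r0 : r = 0.
  by rewrite (subr0_eq r0); exact: orth_proj_in.
apply/normsq_eq0; rewrite -innerE {1}/r innerDl innerNl zo// sub0r innerC ro ?oppr0//.
exact: orth_proj_in.
Qed.

Lemma douglas_rachford_contraction w : orth_compl F w -> `|T w| <= c * `|w|.
Proof.
move=> wF; rewrite -(ler_pXn2r (n := 2)) ?nnegrE ?mulr_ge0 ?friedrichs_cos_ge0//.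
rewrite exprMn (norm_douglas_rachford _ csV) (orth_proj_pythagoras csU w) mulrDr -/P -/Q.
apply: lerD.
  rewrite -exprMn ler_pXn2r ?nnegrE ?mulr_ge0 ?friedrichs_cos_ge0//.
  apply: norm_projr_le_friedrichs; first exact: orth_proj_in.
  apply: orth_proj_preserves_orth => [//|f []//|f UVf]; apply: wF.
  by exists f => //; exists 0; [exact: subspace0 csC.1 | rewrite addr0].
have zU : orth_compl U (w - P w) by exact: orth_proj_res.
(* Being orthogonal to [F] and to [U], the part [w - P w] is in U + V, so it is the [P]-residual of
   some [v] to which [norm_res_le_friedrichs] applies. *)
have [|v [Vv vo]] := @sum_residual (w - P w).
  apply: orth_orthI_sum => f [fU fV]; rewrite innerDl innerNl wF.
    by rewrite innerC fU ?subrr//; exact: orth_proj_in.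
  by exists 0; [exact: subspace0 csUV.1 | exists f; rewrite ?add0r].
rewrite {2}/P (orth_proj_orth sU zU) subr0 => ->; exact: norm_res_le_friedrichs.
Qed.

(** By [firm_fix_adjoint] the complement of [F] is invariant under [T], so the contraction can be
    iterated on the component of [x] there. *)
Lemma douglas_rachford_linear_cvg x n :
  `|iter n T x - orth_proj F x| <= c ^+ n * `|x - orth_proj F x|.
Proof.
pose L := linear_pack (douglas_rachford_linear csU csV).
have firm z : `|L z| ^+ 2 <= inner (L z) z.
  by rewrite le_eqVlt; apply/orP; left; apply/eqP/(douglas_rachford_firm csU csV).
have Ffix f : F f -> L f = f by rewrite -/F /F -(douglas_rachford_fix csU csV).
have [pF xF] := orth_proj_sumFP csU csV x.
have LF w m : orth_compl F w -> orth_compl F (iter m L w) /\ `|iter m L w| <= c ^+ m * `|w|.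
  move=> wF; elim: m => [|m [IHF IH]]; first by rewrite expr0 mul1r.
  split; last first.
    rewrite exprS -mulrA; apply: le_trans (douglas_rachford_contraction IHF) _.
    by rewrite ler_wpM2l// friedrichs_cos_ge0.
  by move=> f Ff; rewrite /= innerC (firm_fix_adjoint firm) ?Ffix// innerC IHF.
have {1}<- : iter n L (orth_proj F x) = orth_proj F x.
  by elim: n => //= n ->; exact: Ffix.
by rewrite -(iter_linearB L n x); exact: (LF _ _ xF).2.
Qed.

(* If [U + V] is closed, the Neumann sums below are pointwise bounded on it, so
   Banach-Steinhaus bounds [id - K ^ n] by [M] times [id - P] on the vectors of
   [V] orthogonal to [U `&` V], where [K = Q \o P \o Q]; there [K ^ n] tends to [0]. *)
Lemma sum_closed_residual_bound : exists M : R,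
  forall v, V v -> orth_compl (U `&` V) v -> `|v| <= M * `|v - P v|.
Proof.
pose K := linear_pack (alternating_proj_linear csU csV).
have firm : forall z, `|K z| ^+ 2 <= inner (K z) z by exact: alternating_proj_firm.
pose S := linear_pack (orth_proj_linear csS).
pose p := linear_pack (orth_proj_linear csU).
pose q := linear_pack (orth_proj_linear csV).
(* Precomposing with the projection [S] onto U + V defines the sums on all of the complete space
   [X]. *)
pose A n x := \sum_(k < n) iter k K (q (S x - p (S x))).
have A_linear n : linear (A n).
  move=> a x y; rewrite /A scaler_sumr -big_split; apply: eq_bigr => k _.
  elim: {k}(val k) => [|k IH]; last by rewrite !iterS IH (linearP K).
  by rewrite /iter (linearP S) (linearP p) opprD addrACA -scalerBr (linearP q).
have A_le n x : `|A n x| <= n%:R * `|x|.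
  rewrite mulr_natl -[n in X in _ <= X]card_ord -sumr_const.
  apply: le_trans (ler_norm_sum _ _ _) _; apply: ler_sum => k _.
  apply: le_trans (firm_iter_nonexpansive firm _ _) _.
  apply: le_trans (norm_orth_proj csV _) _.
  apply: le_trans (norm_orth_proj csS _).
  rewrite -(ler_pXn2r (n := 2)) ?nnegrE//.
  by rewrite [X in _ <= X](orth_proj_pythagoras csU) lerDr sqr_ge0.
(* On [V] the vector q (v - P v) equals v - K v, so the sum telescopes. *)
have A_telescope n x v : V v -> S x - p (S x) = v - P v -> A n x = v - iter n K v.
  move=> Vv xv; rewrite /A xv.
  have -> : q (v - P v) = v - K v.
    by rewrite linearB /= /P; congr (_ - _); rewrite !(orth_proj_id sV Vv).
  elim: n => [|n IH]; first by rewrite big_ord0 subrr.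
  rewrite big_ord_recr -[RHS](subrKA (iter n K v) v); congr (_ + _); first exact: IH.
  by rewrite (iter_linearB K) -iterSr.
(* The radius 1 makes [M] a common bound on the unit ball, extended below by scaling [x]. *)
have [|x|M AM] := @Banach_Steinhauss R X X (range A) _ _ 1.
- move=> _ [n _ <-]; split => // r; exists (n%:R * r) => x xr.
  by apply: le_trans (A_le n x) _; rewrite ler_wpM2l.
- have [v [Vv vo xv]] := sum_residual (orth_proj_in csS x).
  exists (`|v| + `|v|) => _ [n _ <-]; rewrite (A_telescope n x v)//.
  by rewrite (le_trans (ler_normB _ _))// lerD2l (firm_iter_nonexpansive firm).
exists M => v Vv vo; set x := v - P v.
have Sx : S x - p (S x) = x.
  have Px : p x = 0 by apply: orth_proj_orth => //; exact: orth_proj_res.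
  have -> : S x = x; last by rewrite Px subr0.
  apply: orth_proj_id; first exact: csS.1.
  exists (- P v); first by rewrite -scaleN1r; apply: subspaceZ => //; exact: orth_proj_in.
  by exists v => //; rewrite addrC.
have Ax n : `|A n x| <= M * `|x|.
  have [x0|x0] := eqVneq x 0.
    have -> : A n x = 0 by rewrite x0; exact: (raddf0 (linear_pack (A_linear n))).
    by rewrite x0 !normr0 mulr0.
  have xp : 0 < `|x| by rewrite normr_gt0.
  rewrite -ler_pdivrMr// mulrC -[`|x|^-1]gtr0_norm ?invr_gt0// -normrZ.
  rewrite -(linearZ_LR (linear_pack (A_linear n))).
  apply: AM; first by exists n.
  by rewrite normrZ gtr0_norm ?invr_gt0// mulVf// gt_eqF.
have : `|v - iter n K v| @[n --> \oo] --> `|v|.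
  apply: cvg_norm; rewrite -[X in _ --> X]subr0; apply: cvgB; first exact: cvg_cst.
  have := alternating_proj_cvg csU csV (x := v).
  by rewrite orth_proj_orth//; exact: csUV.1.
move=> vKv; apply: ler_cvg_to vKv (cvg_cst (M * `|x|)) _; apply: nearW => n /=.
by rewrite -(A_telescope n x v).
Qed.

(** With [M] from the residual bound, Pythagoras gives |P v|^2 <= 1 - 1/M^2 on the unit ball, and
    <u, v> = <u, P v> <= |P v|. *)
Lemma friedrichs_cos_lt1 : c < 1.
Proof.
have [M0 M0P] := sum_closed_residual_bound.
(* Enlarging the constant to at least 1 makes 1 - 1/M^2 nonnegative under the square root. *)
have [M [M0' M1]] : exists M : R, 1 <= M /\ M0 <= M.
  by exists (`|M0| + 1); rewrite lerDr normr_ge0 (le_trans (ler_norm M0))// lerDl.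
have MP v : V v -> orth_compl (U `&` V) v -> `|v| <= M * `|v - P v|.
  by move=> Vv vo; apply: le_trans (M0P v Vv vo) _; rewrite ler_wpM2r.
have M2 : 0 < M ^+ 2 by rewrite exprn_gt0//; lra.
have i1 : (M ^+ 2)^-1 <= 1 by rewrite invf_le1// expr_ge1//; lra.
apply: (@le_lt_trans _ _ (Num.sqrt (1 - (M ^+ 2)^-1))); last first.
  by rewrite -[ltRHS]sqrtr1 ltr_sqrt// ltrBlDr ltrDl invr_gt0.
apply: friedrichs_cos_ub => u v Uu Vv vo u1 v1.
rewrite -(orth_proj_id sU Uu) inner_orth_projC// -/P.
apply: le_trans (inner_le_norm _ _) _.
apply: (@le_trans _ _ `|P v|); first by rewrite ler_piMl.
rewrite -(ler_pXn2r (n := 2)) ?nnegrE ?sqrtr_ge0// sqr_sqrtr ?subr_ge0//.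
have n1 : `|v| ^+ 2 <= 1 by rewrite expr_le1.
have : `|v| ^+ 2 <= M ^+ 2 * `|v - P v| ^+ 2.
  by rewrite -exprMn ler_pXn2r ?nnegrE ?mulr_ge0 ?MP//; lra.
rewrite -ler_pdivrMl// => nr.
have := orth_proj_pythagoras csU v; rewrite -/P; move: n1 nr i1.
move: (M ^+ 2)^-1 (`|v| ^+ 2) (`|P v| ^+ 2) (`|v - P v| ^+ 2) => i n p r; nra.
Qed.

End Rate.

(** * Convergence and rate for the iterates and their projections onto [U] and [V] *)

Theorem corollary4p4 (R : realType) (X : hilbertType R) (U V : set X)
  (hU : closed_subspace U) (hV : closed_subspace V) (x : X) :
  let T := douglas_rachford U V in
  let cF := friedrichs_cos U V in
  let F := minkowski_sum (U `&` V) (orth_compl U `&` orth_compl V) in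
  [/\ (fun n : nat => iter n T x) @ \oo --> orth_proj F x,
      (fun n : nat => orth_proj U (iter n T x)) @ \oo --> orth_proj (U `&` V) x &
      (fun n : nat => orth_proj V (iter n T x)) @ \oo --> orth_proj (U `&` V) x] /\
  (closed (minkowski_sum U V) ->
   cF < 1 /\
   [/\ linear_cvg cF (fun n : nat => iter n T x) (orth_proj F x),
       linear_cvg cF (fun n : nat => orth_proj U (iter n T x)) (orth_proj (U `&` V) x) &
       linear_cvg cF (fun n : nat => orth_proj V (iter n T x)) (orth_proj (U `&` V) x)]).
Proof.
move=> T cF F.
have cvgT := douglas_rachford_cvg hU hV (x := x).
have PF := orth_projl_F hU hV x; have QF := orth_projr_F hU hV x.
split; first split=> //.
- by rewrite -PF; exact: cvg_orth_proj.
- by rewrite -QF; exact: cvg_orth_proj.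
move=> clUV; have c1 := friedrichs_cos_lt1 hU hV clUV.
have c01 : 0 <= cF < 1 by rewrite c1 andbT; exact: friedrichs_cos_ge0.
have rate n : `|iter n T x - orth_proj F x| <= `|x - orth_proj F x| * cF ^+ n.
  by rewrite mulrC; exact: douglas_rachford_linear_cvg.
(* One constant serves all three sequences, since [P_U] and [P_V] are linear and nonexpansive. *)
split=> //; split; split=> //; exists `|x - orth_proj F x| => // n.
- by rewrite -PF -orth_projB//; apply: le_trans (norm_orth_proj hU _) (rate n).
- by rewrite -QF -orth_projB//; apply: le_trans (norm_orth_proj hV _) (rate n).
Qed.
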